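(* For every $\alpha\in\mathbb{R}\setminus\mathbb{Q}$ and every $g=\begin{pmatrix}a&b\\c&d\end{pmatrix}\in \mathrm{GL}_2(\mathbb{Q})$, one has $\tau(g\alpha)=\tau(\alpha)$, where $g\alpha:=\dfrac{a\alpha+b}{c\alpha+d}$.
   Context: For real $x$, $\|x\|:=\min_{n\in\mathbb{Z}}|x-n|$ denotes the distance from $x$ to the nearest integer. For an irrational real number $\alpha$, the type of $\alpha$ is $$\tau(\alpha):=\sup\big\{\theta\in\mathbb{R}:\liminf_{q\to\infty,\ q\in\mathbb{N}} q^\theta\|q\alpha\|=0\big\}\in[1,\infty].$$ *)

(* Defs.v *)
From mathcomp Require Import all_boot all_order all_algebra.
From mathcomp Require Import all_classical all_reals all_analysis.

Set Implicit Arguments.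
Unset Strict Implicit.
Unset Printing Implicit Defensive.
Import Order.TTheory GRing.Theory Num.Theory.

Local Open Scope classical_set_scope.
Local Open Scope ring_scope.

(* Stated with the real infimum; dist_int_attained and dist_int_le show that
   it is a minimum. *)
Definition dist_int (R : realType) (x : R) : R :=
  inf [set `|x - n%:~R| | n in [set: int]].

Lemma dist_int_le (R : realType) (x : R) (n : int) :
  dist_int x <= `|x - n%:~R|.
Proof.
by apply: ge_inf; [exists 0 => _ [m _ <-]; exact: normr_ge0 | exists n].
Qed.

Lemma dist_int_attained (R : realType) (x : R) :
  exists n : int, dist_int x = `|x - n%:~R|.
Proof.
suff [n nmin] : exists n : int, forall m : int, `|x - n%:~R| <= `|x - m%:~R|.
  exists n; apply/eqP; rewrite eq_le dist_int_le /=.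
  by apply: lb_le_inf; [exists `|x - n%:~R|, n | move=> _ [m _ <-]].
set k := Num.floor x.
have k_le : k%:~R <= x by exact: floor_le.
have lt_k1 : x < (k + 1)%:~R by exact: floorD1_gt.
have near (m : int) :
    (`|x - k%:~R| <= `|x - m%:~R|) || (`|x - (k + 1)%:~R| <= `|x - m%:~R|).
  have [le_mk|lt_km] := leP m k.
    have mk : (m%:~R : R) <= k%:~R by rewrite ler_int.
    rewrite [X in X <= _]ger0_norm ?subr_ge0 //.
    by rewrite ger0_norm ?subr_ge0 ?(le_trans mk) // lerD2l lerN2 mk.
  have km : ((k + 1)%:~R : R) <= m%:~R by rewrite ler_int lezD1.
  apply/orP; right; rewrite ler0_norm; last by rewrite subr_le0 ltW.
  rewrite ler0_norm; last by rewrite subr_le0 (le_trans (ltW lt_k1)).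
  by rewrite lerN2 lerD2l lerN2.
have [le01|lt10] := leP `|x - k%:~R| `|x - (k + 1)%:~R|.
  by exists k => m; case/orP: (near m) => // /(le_trans le01).
by exists (k + 1) => m; case/orP: (near m) => // /(le_trans (ltW lt10)).
Qed.

(* The real exponent theta may be negative, hence powR; the value of the
   sequence at q = 0 does not affect the limit inferior. *)
Definition irrationality_type (R : realType) (alpha : R) : \bar R :=
  ereal_sup [set theta%:E | theta in [set theta : R |
    limn_einf (fun q : nat =>
      ((q%:R `^ theta) * dist_int (q%:R * alpha))%:E) = 0%E]].

Definition moebius (R : realType) (g : 'M[rat]_2) (alpha : R) : R :=
  (ratr (g 0 0) * alpha + ratr (g 0 1)) / (ratr (g 1 0) * alpha + ratr (g 1 1)).

(* Main.v *)
Require Import Defs.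
From mathcomp Require Import all_boot all_order all_algebra.
From mathcomp Require Import all_classical all_reals all_analysis.
From mathcomp Require Import ring lra.

Import Order.TTheory GRing.Theory Num.Theory.

Local Open Scope ring_scope.

(** Write beta = (a alpha + b) / (c alpha + d); after clearing denominators,
    a, b, c, d are integers.  A rational approximation p/q of alpha is carried
    by the same matrix to the approximation (a p + b q) / (c p + d q) of beta,
    and the determinant identity

      (c p + d q) beta - (a p + b q)
        = (a d - b c) (q alpha - p) / (c alpha + d)

    shows that the error is multiplied by a constant, while the new denominator
    c p + d q = q (c alpha + d) - c (q alpha - p) is comparable to q
    ([dist_int_fraction]).  Hence, for theta of either sign
    ([powR_le_comparable]), the analogue of q^theta ||q alpha|| for beta at the
    new denominator is at most a constant times its value, and every theta
    that makes the liminf vanish for alpha also does so for beta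
    ([approx_exponent_transfer]).

    The transfer starts from the relation beta (c alpha + d) = a alpha + b with
    c alpha + d <> 0, the latter being where irrationality of alpha and
    invertibility of g enter.  The adjugate of g gives the relation
    alpha (- c beta + a) = d beta - b of the same form, and - c beta + a <> 0
    because (- c beta + a) (c alpha + d) = det g.  So the two sets of exponents
    are equal, not merely their suprema. *)

(** The infima over the tails are nonnegative and increase to the lower limit,
    so the latter vanishes exactly when each of them does. *)
Lemma limn_einf_eq0P {R : realType} {f : nat -> R} (hf : forall q, 0 <= f q) :
  limn_einf (fun q => (f q)%:E) = 0%E <->
  (forall (e : R) (N : nat), 0 < e -> exists2 q, (N <= q)%N & f q < e).
Proof.
set u : (\bar R)^nat := fun q => (f q)%:E.
have -> : limn_einf u = ereal_sup (range (einfs u)).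
  by rewrite limn_einf_lim; apply: cvg_lim => //; exact: cvg_einfs_sup.
have einfs_ge0 N : (0 <= einfs u N)%E.
  by apply: le_ereal_inf_tmp => _ [q _ <-]; rewrite lee_fin.
split => [sup0 e N e0|small].
  have : (einfs u N < e%:E)%E.
    rewrite (@le_lt_trans _ _ 0%E) ?lte_fin // -sup0.
    by apply: ereal_sup_ubound; exists N.
  by case/ereal_inf_lt => _ [q /= Nq <-]; rewrite lte_fin; exists q.
apply/eqP; rewrite eq_le; apply/andP; split.
  apply: ge_ereal_sup => _ [N _ <-].
  apply/lee_addgt0Pr => e e0; rewrite add0e.
  have [q Nq fq] := small e N e0.
  apply: (@le_trans _ _ (u q)); last by rewrite lee_fin ltW.
  by apply: ereal_inf_lbound; exists q.
by apply: (le_trans (einfs_ge0 0%N)); apply: ereal_sup_ubound; exists 0%N.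
Qed.

Lemma dist_int_ge0 (R : realType) (x : R) : 0 <= dist_int x.
Proof. by have [n ->] := dist_int_attained x; exact: normr_ge0. Qed.

Lemma dist_int_le1 (R : realType) (x : R) : dist_int x <= 1.
Proof.
apply: le_trans (dist_int_le x (Num.floor x)) _.
rewrite ger0_norm ?subr_ge0 ?floor_le //.
by have := floorD1_gt x; rewrite intrD; lra.
Qed.

(** The power function is monotone in a direction that depends on the sign of
    [theta]; adding the two constants covers both cases at once. *)
Lemma powR_le_comparable {R : realType} {l u x y theta : R} :
  0 < l -> 0 < x -> l * x <= y -> y <= u * x ->
  y `^ theta <= (l `^ theta + u `^ theta) * x `^ theta.
Proof.
move=> l0 x0 lxy yux.
have u0 : 0 < u by rewrite -(pmulr_lgt0 _ x0); apply: lt_le_trans yux;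
  apply: lt_le_trans lxy; exact: mulr_gt0.
have lx0 : 0 < l * x by exact: mulr_gt0.
have y0 : 0 < y by exact: lt_le_trans lxy.
rewrite mulrDl -!powRM ?(ltW l0) ?(ltW u0) ?(ltW x0) //.
have [theta0|theta0] := leP 0 theta.
  rewrite (@le_trans _ _ ((u * x) `^ theta)) ?lerDr ?powR_ge0 //.
  by apply: ge0_ler_powR; rewrite ?nnegrE ?(ltW y0) // ltW // mulr_gt0.
rewrite (@le_trans _ _ ((l * x) `^ theta)) ?lerDl ?powR_ge0 //.
rewrite -(opprK theta) powRN (powRN _ (- theta)) lef_pV2 ?posrE ?powR_gt0 //.
by apply: ge0_ler_powR;
  rewrite ?nnegrE ?oppr_ge0 ?(ltW theta0) ?(ltW lx0) ?(ltW y0).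
Qed.

(** With [p] the integer nearest to [q alpha], the multiplier [Q] is the absolute
    value of [c p + d q] and the integer close to [Q beta] is
    [a p + b q] up to sign.  The bounds on [Q] come from
    [c p + d q = q (c alpha + d) - c (q alpha - p)] with
    [q alpha - p] at most one in absolute value. *)
Lemma dist_int_fraction {R : realType} {alpha beta : R} {a b c d : int}
    (q : nat) :
  beta * (c%:~R * alpha + d%:~R) = a%:~R * alpha + b%:~R ->
  c%:~R * alpha + d%:~R != 0 ->
  let C := c%:~R * alpha + d%:~R in
  let K := `|a%:~R * d%:~R - b%:~R * c%:~R| / `|C| in
  exists Q : nat, [/\ q%:R * `|C| - `|c%:~R| <= Q%:R,
    Q%:R <= q%:R * `|C| + `|c%:~R| &
    dist_int (Q%:R * beta) <= K * dist_int (q%:R * alpha)].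
Proof.
move=> hbeta C0 C K.
have [p hp] := dist_int_attained (q%:R * alpha).
pose m : int := c * p + d * q%:Z; pose n : int := a * p + b * q%:Z.
have hm : m%:~R = q%:R * C - c%:~R * (q%:R * alpha - p%:~R).
  by rewrite /m /C intrD !intrM -pmulrn; ring.
have habs : (`|m|%N%:R : R) = `|m%:~R| by rewrite natr_absz intr_norm.
have herr : `|c%:~R * (q%:R * alpha - p%:~R)| <= `|c%:~R : R|.
  by rewrite normrM -hp ler_piMr // dist_int_le1.
have hqC : `|q%:R * C| = q%:R * `|C| by rewrite normrM normr_nat.
have beta_C : beta * C = a%:~R * alpha + b%:~R by [].
exists `|m|%N; split.
- rewrite habs hm -hqC; apply: le_trans (lerB_dist _ _).
  by rewrite lerD2l lerN2.
- rewrite habs hm -hqC; apply: le_trans (ler_normB _ _) _.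
  by rewrite lerD2l.
have hdist : `|m%:~R * beta - n%:~R| = K * dist_int (q%:R * alpha).
  rewrite hp /K mulrAC -normrM.
  apply: (canRL (mulfK _)); first by rewrite normr_eq0.
  rewrite -normrM mulrBl -mulrA beta_C /m /n /C !intrD !intrM -pmulrn.
  by congr `|_|; ring.
(* A negative [m] is replaced by its opposite, and [n] with it. *)
have [m0|m0] := leP 0 m.
  apply: le_trans (dist_int_le _ n) _.
  by rewrite habs (@ger0_norm _ m%:~R) ?ler0z // hdist.
apply: le_trans (dist_int_le _ (- n)) _.
rewrite habs (@ltr0_norm _ m%:~R) ?ltrz0 // -hdist -normrN.
by rewrite intrN le_eqVlt; apply/orP; left; apply/eqP; congr `|_|; ring.
Qed.

(** For large [q] the multiplier [Q] of [dist_int_fraction] lies between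
    [l q] and [u q], so the quantity for [beta] at [Q] is at most a constant
    times the quantity for [alpha] at [q]; and [Q] tends to infinity
    with [q]. *)
Lemma approx_exponent_transfer {R : realType} {alpha beta : R}
    (a b c d : int) {theta : R} :
  beta * (c%:~R * alpha + d%:~R) = a%:~R * alpha + b%:~R ->
  c%:~R * alpha + d%:~R != 0 ->
  limn_einf (fun q : nat => (q%:R `^ theta * dist_int (q%:R * alpha))%:E) = 0%E ->
  limn_einf (fun q : nat => (q%:R `^ theta * dist_int (q%:R * beta))%:E) = 0%E.
Proof.
have ge0 (x : R) q : 0 <= q%:R `^ theta * dist_int (q%:R * x).
  by rewrite mulr_ge0 ?powR_ge0 ?dist_int_ge0.
move=> hbeta C_neq0 /(limn_einf_eq0P (ge0 alpha)) small.
apply/(limn_einf_eq0P (ge0 beta)) => e N e0.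
set C : R := c%:~R * alpha + d%:~R in hbeta C_neq0 *.
pose K : R := `|a%:~R * d%:~R - b%:~R * c%:~R| / `|C|.
have C0 : 0 < `|C| by rewrite normr_gt0.
have K0 : 0 <= K by rewrite divr_ge0.
pose l := `|C| / 2; pose u := `|C| + `|C|.
(* The summand 1 makes [M] positive even when [K] is zero. *)
pose M := (l `^ theta + u `^ theta) * K + 1.
have M0 : 0 < M.
  by rewrite ltr_wpDl // mulr_ge0 // addr_ge0 ?powR_ge0.
(* Beyond [N'], [q |C|] exceeds [2 |c|], which gives the comparability of [Q]
   with [q], and also [2 N], which then gives [N <= Q]. *)
pose N' := (Num.truncn ((`|c%:~R| + `|c%:~R| + N%:R + N%:R) / `|C|)).+1.
have [q N'q hq] := small (e / M) N' (divr_gt0 e0 M0).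
have q_large : `|c%:~R| + `|c%:~R| + N%:R + N%:R < q%:R * `|C|.
  rewrite -ltr_pdivrMr //; apply: lt_le_trans (truncnS_gt _) _.
  by rewrite ler_nat.
have [Q [Qge Qle Qdist]] := dist_int_fraction q hbeta C_neq0.
rewrite -/C -/K in Qge Qle Qdist.
have c0 : 0 <= `|c%:~R : R| by [].
have N0 : (0 : R) <= N%:R by [].
have qC0 : 0 < q%:R * `|C| by lra.
have q0 : (0 : R) < q%:R by rewrite -(pmulr_lgt0 _ C0).
exists Q; first by rewrite -(ler_nat R); lra.
have powQ : Q%:R `^ theta <= (l `^ theta + u `^ theta) * q%:R `^ theta.
  by apply: powR_le_comparable; rewrite ?divr_gt0 // /l /u; lra.
have : Q%:R `^ theta * dist_int (Q%:R * beta) <=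
    M * (q%:R `^ theta * dist_int (q%:R * alpha)).
  apply: le_trans (ler_pM _ _ powQ Qdist) _; rewrite ?powR_ge0 ?dist_int_ge0 //.
  rewrite mulrACA [leRHS]mulrDl mul1r lerDl; exact: ge0.
move=> /le_lt_trans; apply.
by rewrite mulrC -ltr_pdivlMr.
Qed.

Lemma irrational_linear_neq0 {R : realType} {alpha : R} {c d : rat} :
  irrational alpha -> (c != 0) || (d != 0) ->
  ratr c * alpha + ratr d != 0.
Proof.
move=> halpha cd; apply/eqP => h.
have [c0|c0] := eqVneq c 0.
  move: cd h; rewrite c0 eqxx /= rmorph0 mul0r add0r => d0 /eqP.
  by rewrite fmorph_eq0 (negbTE d0).
apply: halpha; exists (- d / c) => //.
have c0' : ratr c != 0 :> R by rewrite fmorph_eq0.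
rewrite fmorph_div rmorphN /=; apply: (canLR (mulfK c0')).
by rewrite mulrC; apply/eqP; rewrite eq_sym -addr_eq0; apply/eqP.
Qed.

(** Reading the sequence as the coefficients of a polynomial reduces this to
    clearing the denominators of a rational polynomial. *)
Lemma common_denominator (s : seq rat) :
  exists2 k : int, k != 0 &
    exists t : nat -> int, forall i, k%:~R * s`_i = (t i)%:~R.
Proof.
have [q [k k0 hs]] := rat_poly_scale (Poly s).
exists k => //; exists (fun i => q`_i) => i.
have k0' : (k%:~R : rat) != 0 by rewrite intr_eq0.
by rewrite -(coef_Poly s i) hs coefZ coef_map mulrA divff // mul1r.
Qed.

(** The hypothesis is homogeneous in the four coefficients, so a common
    denominator can be multiplied in. *)
Lemma approx_exponent_transfer_rat {R : realType} {alpha beta : R}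
    {a b c d : rat} {theta : R} :
  beta * (ratr c * alpha + ratr d) = ratr a * alpha + ratr b ->
  ratr c * alpha + ratr d != 0 ->
  limn_einf (fun q : nat => (q%:R `^ theta * dist_int (q%:R * alpha))%:E) = 0%E ->
  limn_einf (fun q : nat => (q%:R `^ theta * dist_int (q%:R * beta))%:E) = 0%E.
Proof.
move=> hbeta C0.
have [k k0 [t ht]] := common_denominator [:: a; b; c; d].
have ratr_t i : (t i)%:~R = k%:~R * ratr [:: a; b; c; d]`_i :> R.
  by have /(congr1 (@ratr R)) := ht i; rewrite rmorphM /= !ratr_int.
have kR0 : (k%:~R : R) != 0 by rewrite intr_eq0.
have scaleE (x y : R) : k%:~R * x * alpha + k%:~R * y = k%:~R * (x * alpha + y).
  by rewrite mulrDr mulrA.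
apply: (approx_exponent_transfer (t 0%N) (t 1%N) (t 2%N) (t 3%N)).
  by rewrite !ratr_t !scaleE mulrCA hbeta.
by rewrite !ratr_t scaleE mulf_neq0.
Qed.

Lemma det_mx22 {R : comNzRingType} (g : 'M[R]_2) :
  \det g = g 0 0 * g 1 1 - g 0 1 * g 1 0.
Proof.
rewrite (expand_det_row _ 0) !big_ord_recl big_ord0 /cofactor !det_mx11 !mxE /=.
rewrite addr0 expr0 mul1r expr1 mulN1r mulrN.
by congr (_ * _ - _ * _); congr (g _ _); apply: val_inj.
Qed.

Theorem theorem1p1 (R : realType) (alpha : R) (g : 'M[rat]_2)
  (halpha : irrational alpha) (hg : g \in unitmx) :
  irrationality_type (moebius g alpha) = irrationality_type alpha.
Proof.
have det0 : g 0 0 * g 1 1 - g 0 1 * g 1 0 != 0.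
  by rewrite -det_mx22 -unitfE -unitmxE.
have lower_row0 : (g 1 0 != 0) || (g 1 1 != 0).
  apply: contraNT det0; rewrite negb_or !negbK => /andP[/eqP -> /eqP ->].
  by rewrite !mulr0 subrr.
have C0 := irrational_linear_neq0 halpha lower_row0.
have hbeta : moebius g alpha * (ratr (g 1 0) * alpha + ratr (g 1 1)) =
    ratr (g 0 0) * alpha + ratr (g 0 1) by rewrite /moebius mulfVK.
set beta := moebius g alpha in hbeta *.
(* The relation for the adjugate of [g], which exchanges the two numbers. *)
have halphaE : alpha * (ratr (- g 1 0) * beta + ratr (g 0 0)) =
    ratr (g 1 1) * beta + ratr (- g 0 1).
  by move: hbeta; rewrite !rmorphN /=; lra.
have hprod : (ratr (- g 1 0) * beta + ratr (g 0 0)) *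
    (ratr (g 1 0) * alpha + ratr (g 1 1)) =
    ratr (g 0 0 * g 1 1 - g 0 1 * g 1 0) :> R.
  by rewrite mulrDl -mulrA hbeta rmorphB !rmorphM rmorphN /=; ring.
have C'0 : ratr (- g 1 0) * beta + ratr (g 0 0) != 0.
  apply: contraNneq det0 => h; move: hprod; rewrite h mul0r => /esym/eqP.
  by rewrite fmorph_eq0.
congr ereal_sup; congr image; apply/seteqP; split => theta /=.
  exact: approx_exponent_transfer_rat halphaE C'0.
exact: approx_exponent_transfer_rat hbeta C0.
Qed.
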